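(* Suppose $\mathcal K$ is a rigid monoidal triangulated category and $\mathcal L$ is a duo monoidal triangulated category (both essentially small). Suppose that the exact $\otimes$-functor $F\colon\mathcal K\to\mathcal L$ detects $\otimes$-nilpotents of morphisms, i.e. every morphism $f\colon x\to y$ in $\mathcal K$ such that $F(f)=0$ satisfies $f^{\otimes n}=0$ for some $n\geq1$. Then the induced map $\varphi\colon\operatorname{Spc}^{cp}(\mathcal L)\to\operatorname{Spc}^{cp}(\mathcal K)$, $\mathcal Q\mapsto F^{-1}(\mathcal Q)$, is surjective.
   Context: A monoidal triangulated category is a monoidal category (tensor $\otimes$, unit $\mathbf 1$) which is triangulated and for which $\otimes$ is an exact bifunctor. An exact $\otimes$-functor is an exact monoidal functor. A thick subcategory is a full triangulated subcategory closed under direct summands; a thick right (resp. left, two-sided) $\otimes$-ideal is a thick subcategory closed under right (resp. left, both left and right) tensoring with arbitrary objects. $\mathcal L$ is duo if every thick right $\otimes$-ideal and every thick left $\otimes$-ideal of $\mathcal L$ is two-sided. $\mathcal K$ is rigid if every object $x$ has a left dual $x^\vee$ and a right dual ${}^\vee x$, these defining exact contravariant functors on $\mathcal K$. A proper thick two-sided $\otimes$-ideal $\mathcal P$ is completely prime if $x\otimes y\in\mathcal P$ implies $x\in\mathcal P$ or $y\in\mathcal P$; $\operatorname{Spc}^{cp}(\mathcal K)$ is the set of completely prime thick $\otimes$-ideals. *)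

(* Defs.v *)
From HB Require Import structures.
From mathcomp Require Import all_boot all_algebra.
From mathcomp Require Import boolp classical_sets.

Set Implicit Arguments.
Unset Strict Implicit.
Unset Printing Implicit Defensive.

Import GRing.Theory.
Local Open Scope ring_scope.

Declare Scope cat_scope.
Delimit Scope cat_scope with cat.
Local Open Scope cat_scope.

Reserved Notation "g ∘ f" (at level 40, left associativity).
Reserved Notation "x ⊗ y" (at level 39, left associativity).
Reserved Notation "f ⊗₁ g" (at level 39, left associativity).

(* The objects form a type, so that all categories are small relative to a
   larger universe; an essentially small category is represented by an
   equivalent small one.  [comp g f] is "g after f". *)
Record preaddCat := PreaddCat {
  obj :> Type;
  hom : obj -> obj -> zmodType;
  idm : forall x, hom x x;
  comp : forall x y z, hom y z -> hom x y -> hom x z;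
  comp1m : forall x y (f : hom x y), comp (idm y) f = f;
  compm1 : forall x y (f : hom x y), comp f (idm x) = f;
  compA : forall x y z w (h : hom z w) (g : hom y z) (f : hom x y),
    comp h (comp g f) = comp (comp h g) f;
  compDl : forall x y z (g g' : hom y z) (f : hom x y),
    comp (g + g') f = comp g f + comp g' f;
  compDr : forall x y z (g : hom y z) (f f' : hom x y),
    comp g (f + f') = comp g f + comp g f' }.

Arguments hom {C} x y : rename.
Arguments idm {C} x : rename.
Arguments comp {C x y z} g f : rename.

Notation "g ∘ f" := (comp g f) : cat_scope.

Section Additive.
Variable C : preaddCat.

Definition inverse_isos (x y : C) (f : hom x y) (g : hom y x) : Prop :=
  g ∘ f = idm x /\ f ∘ g = idm y.

Definition is_iso (x y : C) (f : hom x y) : Prop :=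
  exists g : hom y x, inverse_isos f g.

(* Initial and terminal; the unique morphism is then necessarily 0. *)
Definition is_zero (z : C) : Prop :=
  forall x : C, (forall f : hom x z, f = 0) /\ (forall f : hom z x, f = 0).

(* [s] is a direct sum of [x] and [y]. *)
Definition is_biproduct (x y s : C) (i1 : hom x s) (i2 : hom y s)
    (p1 : hom s x) (p2 : hom s y) : Prop :=
  [/\ p1 ∘ i1 = idm x, p2 ∘ i2 = idm y, p1 ∘ i2 = 0, p2 ∘ i1 = 0
    & i1 ∘ p1 + i2 ∘ p2 = idm s].

Definition additive_category : Prop :=
  (exists z : C, is_zero z) /\
  (forall x y : C, exists (s : C) (i1 : hom x s) (i2 : hom y s)
     (p1 : hom s x) (p2 : hom s y), is_biproduct i1 i2 p1 p2).

End Additive.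

Record functor (C D : preaddCat) := Functor {
  fobj :> C -> D;
  fmap : forall x y : C, hom x y -> hom (fobj x) (fobj y);
  fmap1 : forall x, fmap (idm x) = idm (fobj x);
  fmapM : forall x y z (g : hom y z) (f : hom x y),
    fmap (g ∘ f) = fmap g ∘ fmap f }.

Arguments fmap {C D} F {x y} f : rename.

Definition additive_functor (C D : preaddCat) (F : functor C D) : Prop :=
  forall (x y : C) (f g : hom x y), fmap F (f + g) = fmap F f + fmap F g.

Definition equivalence (C D : preaddCat) (F : functor C D) : Prop :=
  exists G : functor D C,
    (exists u : forall x : C, hom x (G (F x)), (forall x, is_iso (u x)) /\
       forall x y (f : hom x y), u y ∘ f = fmap G (fmap F f) ∘ u x) /\
    (exists v : forall x : D, hom (F (G x)) x, (forall x, is_iso (v x)) /\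
       forall x y (f : hom x y), v y ∘ fmap F (fmap G f) = f ∘ v x).

(* [dist f g h] says that x -f-> y -g-> z -h-> Σx is a distinguished
   triangle. *)
Record triCat := TriCat {
  tri_cat :> preaddCat;
  tri_additive : additive_category tri_cat;
  shift : functor tri_cat tri_cat;
  shift_additive : additive_functor shift;
  shift_equivalence : equivalence shift;
  dist : forall x y z : tri_cat,
    hom x y -> hom y z -> hom z (shift x) -> Prop;
  (* TR1 *)
  dist_iso : forall x y z x' y' z' (f : hom x y) (g : hom y z)
      (h : hom z (shift x)) (f' : hom x' y') (g' : hom y' z')
      (h' : hom z' (shift x')) (a : hom x x') (b : hom y y') (c : hom z z'),
    is_iso a -> is_iso b -> is_iso c ->
    b ∘ f = f' ∘ a -> c ∘ g = g' ∘ b -> fmap shift a ∘ h = h' ∘ c ->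
    dist f g h -> dist f' g' h';
  dist_id : forall x z : tri_cat, is_zero z ->
    dist (idm x) (0 : hom x z) (0 : hom z (shift x));
  dist_cone : forall x y (f : hom x y),
    exists z (g : hom y z) (h : hom z (shift x)), dist f g h;
  (* TR2 *)
  dist_rot : forall x y z (f : hom x y) (g : hom y z) (h : hom z (shift x)),
    dist f g h <-> dist g h (- fmap shift f);
  (* TR3 *)
  dist_morph : forall x y z x' y' z' (f : hom x y) (g : hom y z)
      (h : hom z (shift x)) (f' : hom x' y') (g' : hom y' z')
      (h' : hom z' (shift x')) (a : hom x x') (b : hom y y'),
    dist f g h -> dist f' g' h' -> b ∘ f = f' ∘ a ->
    exists c : hom z z', c ∘ g = g' ∘ b /\ fmap shift a ∘ h = h' ∘ c;
  (* TR4, the octahedral axiom *)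
  dist_oct : forall x y z x' y' z' (f : hom x y) (g : hom y z)
      (f1 : hom y z') (f2 : hom z' (shift x))
      (g1 : hom z x') (g2 : hom x' (shift y))
      (h1 : hom z y') (h2 : hom y' (shift x)),
    dist f f1 f2 -> dist g g1 g2 -> dist (g ∘ f) h1 h2 ->
    exists (u : hom z' y') (v : hom y' x'),
      [/\ dist u v (fmap shift f1 ∘ g2),
          u ∘ f1 = h1 ∘ g, h2 ∘ u = f2,
          v ∘ h1 = g1 & g2 ∘ v = fmap shift f ∘ h2] }.

Arguments shift {C} : rename.
Arguments dist {C x y z} f g h : rename.

(* The isomorphism F(Σx) ≅ ΣF(x) is required to exist and is not part of
   the data. *)
Definition exact_functor (C D : triCat) (F : functor C D) : Prop :=
  additive_functor F /\
  exists th : forall x : C, hom (F (shift x)) (shift (F x)),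
    [/\ forall x, is_iso (th x),
        forall x y (f : hom x y),
          th y ∘ fmap F (fmap shift f) = fmap shift (fmap F f) ∘ th x
      & forall x y z (f : hom x y) (g : hom y z) (h : hom z (shift x)),
          dist f g h -> dist (fmap F f) (fmap F g) (th x ∘ fmap F h)].

(* The contravariant assignment D is a functor and sends a triangle
   x -> y -> z -> Σx to a triangle Dz -> Dy -> Dx -> ΣDz, where the last map
   is formed with an isomorphism Dx ≅ ΣD(Σx), equivalently
   D(Σx) ≅ Σ^-1(Dx).  This is exactness of D on the opposite category;
   the usual sign in the triangulation of the latter is absorbed in th. *)
Definition exact_contra_functor (C : triCat) (D : C -> C)
    (Dm : forall x y : C, hom x y -> hom (D y) (D x)) : Prop :=
  [/\ forall x, Dm x x (idm x) = idm (D x),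
      forall x y z (g : hom y z) (f : hom x y),
        Dm x z (g ∘ f) = Dm x y f ∘ Dm y z g,
      forall x y (f g : hom x y), Dm x y (f + g) = Dm x y f + Dm x y g
    & exists th : forall x : C, hom (D x) (shift (D (shift x))),
        [/\ forall x, is_iso (th x),
            forall x y (f : hom x y),
              fmap shift (Dm _ _ (fmap shift f)) ∘ th y = th x ∘ Dm _ _ f
          & forall x y z (f : hom x y) (g : hom y z) (h : hom z (shift x)),
              dist f g h ->
              dist (Dm _ _ g) (Dm _ _ f) (fmap shift (Dm _ _ h) ∘ th x)]].

Record monoidal (C : preaddCat) := Monoidal {
  tunit : C;
  tens : C -> C -> C;
  tensm : forall x x' y y' : C,
    hom x x' -> hom y y' -> hom (tens x y) (tens x' y');
  tensm1 : forall x y, tensm (idm x) (idm y) = idm (tens x y);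
  tensmM : forall x x' x'' y y' y'' (f' : hom x' x'') (f : hom x x')
      (g' : hom y' y'') (g : hom y y'),
    tensm (f' ∘ f) (g' ∘ g) = tensm f' g' ∘ tensm f g;
  assoc : forall x y z, hom (tens (tens x y) z) (tens x (tens y z));
  assocV : forall x y z, hom (tens x (tens y z)) (tens (tens x y) z);
  assocK : forall x y z, inverse_isos (assoc x y z) (assocV x y z);
  assoc_nat : forall x x' y y' z z' (f : hom x x') (g : hom y y')
      (h : hom z z'),
    assoc x' y' z' ∘ tensm (tensm f g) h = tensm f (tensm g h) ∘ assoc x y z;
  lunit : forall x, hom (tens tunit x) x;
  lunitV : forall x, hom x (tens tunit x);
  lunitK : forall x, inverse_isos (lunit x) (lunitV x);
  lunit_nat : forall x y (f : hom x y),
    lunit y ∘ tensm (idm tunit) f = f ∘ lunit x;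
  runit : forall x, hom (tens x tunit) x;
  runitV : forall x, hom x (tens x tunit);
  runitK : forall x, inverse_isos (runit x) (runitV x);
  runit_nat : forall x y (f : hom x y),
    runit y ∘ tensm f (idm tunit) = f ∘ runit x;
  pentagon : forall x y z w,
    assoc x y (tens z w) ∘ assoc (tens x y) z w =
    tensm (idm x) (assoc y z w) ∘ assoc x (tens y z) w
      ∘ tensm (assoc x y z) (idm w);
  triangle : forall x y,
    tensm (idm x) (lunit y) ∘ assoc x tunit y = tensm (runit x) (idm y) }.

(* Exact in each variable, the two suspension isomorphisms being natural in
   both variables; no sign compatibility between them is imposed. *)
Definition exact_bifunctor (C : triCat) (M : monoidal C) : Prop :=
  [/\ forall (x x' y y' : C) (f f' : hom x x') (g : hom y y'),
        tensm M (f + f') g = tensm M f g + tensm M f' g,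
      forall (x x' y y' : C) (f : hom x x') (g g' : hom y y'),
        tensm M f (g + g') = tensm M f g + tensm M f g',
      exists th : forall x y : C,
          hom (tens M (shift x) y) (shift (tens M x y)),
        [/\ forall x y, is_iso (th x y),
            forall x x' y y' (f : hom x x') (g : hom y y'),
              th x' y' ∘ tensm M (fmap shift f) g
                = fmap shift (tensm M f g) ∘ th x y
          & forall x y z w (f : hom x y) (g : hom y z)
                (h : hom z (shift x)), dist f g h ->
              dist (tensm M f (idm w)) (tensm M g (idm w))
                (th x w ∘ tensm M h (idm w))]
    & exists th : forall x y : C,
          hom (tens M x (shift y)) (shift (tens M x y)),
        [/\ forall x y, is_iso (th x y),
            forall x x' y y' (f : hom x x') (g : hom y y'),
              th x' y' ∘ tensm M f (fmap shift g)
                = fmap shift (tensm M f g) ∘ th x y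
          & forall x y z w (f : hom x y) (g : hom y z)
                (h : hom z (shift x)), dist f g h ->
              dist (tensm M (idm w) f) (tensm M (idm w) g)
                (th w x ∘ tensm M (idm w) h)]].

Record monTriCat := MonTriCat {
  mt_tri :> triCat;
  mt_monoidal : monoidal mt_tri;
  mt_exact : exact_bifunctor mt_monoidal }.

Notation "x ⊗ y" := (tens (mt_monoidal _) x y) : cat_scope.
Notation "f ⊗₁ g" := (tensm (mt_monoidal _) f g) : cat_scope.
Notation unit_obj K := (tunit (mt_monoidal K)).
Notation α := (assoc (mt_monoidal _)).
Notation αV := (assocV (mt_monoidal _)).
Notation λ := (lunit (mt_monoidal _)).
Notation λV := (lunitV (mt_monoidal _)).
Notation ρ := (runit (mt_monoidal _)).
Notation ρV := (runitV (mt_monoidal _)).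

(* A strong monoidal functor which is exact. *)
Record exactTensorFunctor (K L : monTriCat) := ExactTensorFunctor {
  etf_functor :> functor K L;
  etf_exact : exact_functor etf_functor;
  etf_mu : forall x y : K,
    hom (etf_functor x ⊗ etf_functor y) (etf_functor (x ⊗ y));
  etf_mu_iso : forall x y, is_iso (etf_mu x y);
  etf_mu_nat : forall (x x' y y' : K) (f : hom x x') (g : hom y y'),
    etf_mu x' y' ∘ (fmap etf_functor f ⊗₁ fmap etf_functor g)
      = fmap etf_functor (f ⊗₁ g) ∘ etf_mu x y;
  etf_eps : hom (unit_obj L) (etf_functor (unit_obj K));
  etf_eps_iso : is_iso etf_eps;
  etf_assoc : forall x y z : K,
    fmap etf_functor (α x y z) ∘ etf_mu (x ⊗ y) z
        ∘ (etf_mu x y ⊗₁ idm (etf_functor z))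
      = etf_mu x (y ⊗ z) ∘ (idm (etf_functor x) ⊗₁ etf_mu y z)
        ∘ α (etf_functor x) (etf_functor y) (etf_functor z);
  etf_lunit : forall x : K,
    fmap etf_functor (λ x) ∘ etf_mu (unit_obj K) x
        ∘ (etf_eps ⊗₁ idm (etf_functor x))
      = λ (etf_functor x);
  etf_runit : forall x : K,
    fmap etf_functor (ρ x) ∘ etf_mu x (unit_obj K)
        ∘ (idm (etf_functor x) ⊗₁ etf_eps)
      = ρ (etf_functor x) }.

Section Rigid.
Variable K : monTriCat.

(* [d] is a left dual of [x]; equivalently [x] is a right dual of [d]. *)
Definition is_left_dual (d x : K) (ev : hom (d ⊗ x) (unit_obj K))
    (coev : hom (unit_obj K) (x ⊗ d)) : Prop :=
  ρ x ∘ (idm x ⊗₁ ev) ∘ α x d x ∘ (coev ⊗₁ idm x) ∘ λV x = idm x /\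
  λ d ∘ (ev ⊗₁ idm d) ∘ αV d x d ∘ (idm d ⊗₁ coev) ∘ ρV d = idm d.

(* The morphism y^v -> x^v dual to f : x -> y. *)
Definition left_dual_map (D : K -> K)
    (ev : forall x, hom (D x ⊗ x) (unit_obj K))
    (coev : forall x, hom (unit_obj K) (x ⊗ D x))
    (x y : K) (f : hom x y) : hom (D y) (D x) :=
  λ (D x) ∘ (ev y ⊗₁ idm (D x)) ∘ αV (D y) y (D x)
    ∘ (idm (D y) ⊗₁ (f ⊗₁ idm (D x))) ∘ (idm (D y) ⊗₁ coev x) ∘ ρV (D y).

Definition right_dual_map (D : K -> K)
    (ev : forall x, hom (x ⊗ D x) (unit_obj K))
    (coev : forall x, hom (unit_obj K) (D x ⊗ x))
    (x y : K) (f : hom x y) : hom (D y) (D x) :=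
  ρ (D x) ∘ (idm (D x) ⊗₁ ev y) ∘ α (D x) y (D y)
    ∘ ((idm (D x) ⊗₁ f) ⊗₁ idm (D y)) ∘ (coev x ⊗₁ idm (D y)) ∘ λV (D y).

Definition rigid : Prop :=
  (exists (D : K -> K) (ev : forall x, hom (D x ⊗ x) (unit_obj K))
     (coev : forall x, hom (unit_obj K) (x ⊗ D x)),
     (forall x, is_left_dual (ev x) (coev x)) /\
     exact_contra_functor (left_dual_map ev coev)) /\
  (exists (D : K -> K) (ev : forall x, hom (x ⊗ D x) (unit_obj K))
     (coev : forall x, hom (unit_obj K) (D x ⊗ x)),
     (forall x, is_left_dual (ev x) (coev x)) /\
     exact_contra_functor (right_dual_map ev coev)).

End Rigid.

Section Ideals.
Variable K : monTriCat.

(* A full subcategory is given by its set of objects. *)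
Definition thick (T : set K) : Prop :=
  [/\ forall z, is_zero z -> T z,
      forall x, T x <-> T (shift x),
      forall x y z (f : hom x y) (g : hom y z) (h : hom z (shift x)),
        dist f g h -> T x -> T y -> T z
    & forall x y s (i1 : hom x s) (i2 : hom y s) (p1 : hom s x)
        (p2 : hom s y), is_biproduct i1 i2 p1 p2 -> T s -> T x /\ T y].

Definition thick_right_ideal (T : set K) : Prop :=
  thick T /\ forall x y, T x -> T (x ⊗ y).

Definition thick_left_ideal (T : set K) : Prop :=
  thick T /\ forall x y, T x -> T (y ⊗ x).

Definition thick_ideal (T : set K) : Prop :=
  [/\ thick T, forall x y, T x -> T (x ⊗ y) & forall x y, T x -> T (y ⊗ x)].

Definition duo : Prop :=
  (forall T, thick_right_ideal T -> thick_ideal T) /\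
  (forall T, thick_left_ideal T -> thick_ideal T).

Definition completely_prime (P : set K) : Prop :=
  [/\ thick_ideal P, P <> setT & forall x y, P (x ⊗ y) -> P x \/ P y].

End Ideals.

Arguments duo K : clear implicits.

Record Spc_cp (K : monTriCat) := SpcCp {
  spc_set :> set K;
  spc_prime : completely_prime spc_set }.

Section Preimage.

Lemma comp0m (C : preaddCat) (x y z : C) (f : hom x y) :
  (0 : hom y z) ∘ f = 0.
Proof. by apply: (addrI (0 ∘ f)); rewrite -compDl !addr0. Qed.

Lemma compm0 (C : preaddCat) (x y z : C) (f : hom y z) :
  f ∘ (0 : hom x y) = 0.
Proof. by apply: (addrI (f ∘ 0)); rewrite -compDr !addr0. Qed.

Lemma fmap0 (C D : preaddCat) (F : functor C D) (x y : C) :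
  additive_functor F -> fmap F (0 : hom x y) = 0.
Proof. by move=> FD; apply: (addrI (fmap F 0)); rewrite -FD !addr0. Qed.

Lemma is_zero_id (C : preaddCat) (z : C) : idm z = 0 -> is_zero z.
Proof.
by move=> z0 x; split=> f; [rewrite -(comp1m f) | rewrite -(compm1 f)];
  rewrite z0 ?comp0m ?compm0.
Qed.

Lemma thick_iso (K : monTriCat) (T : set K) (x y : K) (f : hom x y) :
  thick T -> is_iso f -> T x <-> T y.
Proof.
move=> [_ _ _ Tsum].
have key a b (u : hom a b) (v : hom b a) : inverse_isos u v -> T a -> T b.
  move=> [vu uv] Ta; have [[z z0] _] := tri_additive K.
  have [] // := Tsum b z a v 0 u 0 _ Ta.
  split; rewrite ?comp0m ?compm0 ?addr0 //.
  by rewrite ((z0 z).1 (idm z)).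
by move=> [g [gf fg]]; split; [apply: (key _ _ f g) | apply: (key _ _ g f)].
Qed.

Lemma completely_prime_preimage (K L : monTriCat)
    (F : exactTensorFunctor K L) (Q : set L) :
  completely_prime Q -> completely_prime (F @^-1` Q)%classic.
Proof.
move=> [[Qth QR QL] Qproper Qprime].
have [Q0 Qshift Qtri Qsum] := Qth.
have [Fadd [th [th_iso _ th_dist]]] := etf_exact F.
have Qmu x y : Q (F x ⊗ F y) <-> Q (F (x ⊗ y)).
  by apply: thick_iso => //; apply: (etf_mu_iso F x y).
split; [split; [split|..]|..] => /=.
- move=> z z0; apply: Q0; apply: is_zero_id.
  by rewrite -fmap1 ((z0 z).1 (idm z)) fmap0.
- by move=> x; rewrite /preimage /= Qshift; apply: iff_sym;
    apply: (thick_iso Qth (th_iso x)).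
- by move=> x y z f g h /th_dist; apply: Qtri.
- move=> x y s i1 i2 p1 p2 [h1 h2 h3 h4 h5].
  apply: (Qsum _ _ _ (fmap F i1) (fmap F i2) (fmap F p1) (fmap F p2)).
  by split; rewrite -!fmapM ?h1 ?h2 ?h3 ?h4 ?fmap1 ?fmap0 // -Fadd h5 fmap1.
- by move=> x y Qx; apply/Qmu/QR.
- by move=> x y Qx; apply/Qmu/QL.
- move=> PT; apply: Qproper; apply/seteqP; split=> // y _.
  have Q1 : Q (unit_obj L).
    apply/(thick_iso Qth (etf_eps_iso F)).
    by have : (F @^-1` Q)%classic (unit_obj K) by rewrite PT.
  apply/(thick_iso Qth (f := λ y)); last exact: QR.
  by exists (λV y); apply: lunitK.
- by move=> x y /Qmu /Qprime.
Qed.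

End Preimage.

Definition Spc_cp_map (K L : monTriCat) (F : exactTensorFunctor K L)
    (Q : Spc_cp L) : Spc_cp K :=
  SpcCp (completely_prime_preimage F (spc_prime Q)).

Fixpoint tpow (K : monTriCat) (x : K) (n : nat) : K :=
  match n with
  | 0 => unit_obj K
  | 1 => x
  | n'.+1 => x ⊗ tpow x n'
  end.

Fixpoint tpowm (K : monTriCat) (x y : K) (f : hom x y) (n : nat) :
    hom (tpow x n) (tpow y n) :=
  match n with
  | 0 => idm (unit_obj K)
  | n'.+1 =>
    match n' return hom (tpow x n') (tpow y n') ->
        hom (tpow x n'.+1) (tpow y n'.+1) with
    | 0 => fun=> f
    | _.+1 => fun fn => f ⊗₁ fn
    end (tpowm f n')
  end.

Definition detects_tensor_nilpotents (K L : monTriCat)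
    (F : exactTensorFunctor K L) : Prop :=
  forall (x y : K) (f : hom x y), fmap F f = 0 ->
    exists2 n : nat, (0 < n)%N & tpowm f n = 0.

(* Main.v *)
(* Call a morphism of K a P-morphism if its cone lies in P.  Let J be the set
   of objects d of L such that F(xi) ⊗ d = 0 for some P-morphism xi : w -> 1.
   It is a thick right ideal, hence two-sided since L is duo.  It contains
   F(P): for x in P the fibre xi of coev : 1 -> x ⊗ x^v has cone x ⊗ x^v, and
   xi ⊗ x = 0 because coev ⊗ x is a split monomorphism.  If F(s) is in J then
   F(xi ⊗ s) = 0, so some power of the P-morphism xi ⊗ s is zero; a zero
   P-morphism has its target in P, so a power of s, hence s, is in P.  Thus J
   avoids the multiplicative set F(K \ P), and an ideal containing J which is
   maximal with this property is completely prime, again since L is duo. *)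
From mathcomp Require Import all_boot all_algebra.
From mathcomp Require Import boolp classical_sets.
Require Import Defs.

Set Implicit Arguments.
Unset Strict Implicit.
Unset Printing Implicit Defensive.

Import GRing.Theory.
Local Open Scope classical_set_scope.
Local Open Scope ring_scope.
Local Open Scope cat_scope.

(** * Cancellation of isomorphisms, and full faithfulness of equivalences *)

Section Preadditive.
Variable C : preaddCat.

Lemma compNm (x y z : C) (g : hom y z) (f : hom x y) : (- g) ∘ f = - (g ∘ f).
Proof. by apply/eqP; rewrite -addr_eq0 -compDl addNr comp0m. Qed.

Lemma compmN (x y z : C) (g : hom y z) (f : hom x y) : g ∘ (- f) = - (g ∘ f).
Proof. by apply/eqP; rewrite -addr_eq0 -compDr addNr compm0. Qed.

Lemma idm_iso (x : C) : is_iso (idm x).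
Proof. by exists (idm x); split; apply: comp1m. Qed.

Lemma iso_cancell (x y z : C) (f : hom y z) (g g' : hom x y) :
  is_iso f -> f ∘ g = f ∘ g' -> g = g'.
Proof.
by move=> [i [fK _]] e; rewrite -(comp1m g) -(comp1m g') -fK -!compA e.
Qed.

Lemma iso_cancelr (x y z : C) (f : hom x y) (g g' : hom y z) :
  is_iso f -> g ∘ f = g' ∘ f -> g = g'.
Proof.
by move=> [i [_ fK]] e; rewrite -(compm1 g) -(compm1 g') -fK !compA e.
Qed.

Lemma iso_comp_eq0 (x y z : C) (f : hom y z) (g : hom x y) :
  is_iso f -> f ∘ g = 0 -> g = 0.
Proof. by move=> fi; rewrite -(compm0 x f); apply: iso_cancell. Qed.

Lemma comp_iso_eq0 (x y z : C) (f : hom x y) (g : hom y z) :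
  is_iso f -> g ∘ f = 0 -> g = 0.
Proof. by move=> fi; rewrite -(comp0m z f); apply: iso_cancelr. Qed.

End Preadditive.

Lemma equivalence_faithful (C D : preaddCat) (F : functor C D) (x y : C)
    (f g : hom x y) : equivalence F -> fmap F f = fmap F g -> f = g.
Proof.
move=> [G [[u [ui unat]] _]] e.
by apply: (iso_cancell (ui y)); rewrite !unat e.
Qed.

Lemma equivalence_full (C D : preaddCat) (F : functor C D) (x y : C)
    (g : hom (F x) (F y)) : equivalence F -> exists f : hom x y, fmap F f = g.
Proof.
move=> [G [[u [ui unat]] [v [vi vnat]]]].
have [uV [uK Ku]] := ui y.
exists (uV ∘ (fmap G g ∘ u x)).
(* Naturality of [v] makes [G] faithful, so it suffices to compare images under [G]. *)
suff e : fmap G (fmap F (uV ∘ (fmap G g ∘ u x))) = fmap G g.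
  by apply: (iso_cancelr (vi _)); rewrite -!vnat e.
by apply: (iso_cancelr (ui x)); rewrite -unat compA Ku comp1m.
Qed.

(** * Weak cokernels and fibres in a triangulated category *)

Section Triangles.
Variable C : triCat.

Lemma dist_comp0 (x y z : C) (f : hom x y) (g : hom y z)
    (h : hom z (shift x)) : dist f g h -> g ∘ f = 0.
Proof.
move=> d; have [[o o0] _] := tri_additive C.
have [|c [<- _]] := dist_morph (a := idm x) (b := f) (dist_id x o0) d.
  by [].
by rewrite compm0.
Qed.

(** The second map of a triangle is a weak cokernel of the first: TR3 gives a morphism to the
    triangle 0 -> t = t -> 0. *)
Lemma dist_lift (x y z t : C) (f : hom x y) (g : hom y z)
    (h : hom z (shift x)) (k : hom y t) :
  dist f g h -> k ∘ f = 0 -> exists l : hom z t, l ∘ g = k.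
Proof.
move=> d kf; have [[o o0] _] := tri_additive C.
have so0 : is_zero (shift o).
  apply: is_zero_id; rewrite -fmap1 ((o0 o).1 (idm o)).
  exact: fmap0 (@shift_additive C).
have d0 : dist (0 : hom o t) (idm t) (0 : hom t (shift o)).
  apply/dist_rot; rewrite ((so0 _).2 (- _)); exact: dist_id.
have [|c [cg _]] := dist_morph (a := 0 : hom x o) (b := k) d d0.
  by rewrite kf comp0m.
by exists c; rewrite cg comp1m.
Qed.

(** The cone of [g] is desuspended using essential surjectivity of the shift, and its last map using
    fullness. *)
Lemma dist_fiber (y z : C) (g : hom y z) :
  exists x (f : hom x y) (h : hom z (shift x)), dist f g h.
Proof.
have [c [k [l d]]] := dist_cone g.
have eqS := shift_equivalence C.
have [G [_ [v [vi _]]]] := eqS.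
have [vV [vK Kv]] := vi c.
have [f fE] := equivalence_full (l ∘ v c) eqS.
exists (G c), (- f), (vV ∘ k); apply/dist_rot.
(* Rotation introduces a sign, which the choice of [- f] cancels. *)
have -> : - fmap shift (- f) = fmap shift f :> hom (shift (G c)) (shift y).
  apply/eqP; rewrite eq_sym -subr_eq0 opprK -(@shift_additive C) subrr.
  by rewrite fmap0 //; exact: shift_additive.
apply: (dist_iso (a := idm y) (b := idm z) (c := vV) _ _ _ _ _ _ d);
  rewrite ?fmap1 ?comp1m ?compm1 //; try exact: idm_iso.
- by exists (v c); split.
- by rewrite fE -compA Kv compm1.
Qed.

End Triangles.

(** * Morphisms with cone in a thick subcategory *)

Section Thick.
Variables (K : monTriCat) (T : set K).
Hypothesis T_thick : thick T.

Lemma thick_dist2 (x y z : K) (f : hom x y) (g : hom y z)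
    (h : hom z (shift x)) : dist f g h -> T x -> T z -> T y.
Proof.
have [_ Tshift Ttri _] := T_thick.
move=> /dist_rot /dist_rot d Tx Tz.
by apply: (Tshift _).2; apply: Ttri d Tz _; apply: (Tshift _).1.
Qed.

(** These are the morphisms that become invertible in the Verdier quotient by [T]. *)
Definition cone_in (x y : K) (f : hom x y) : Prop :=
  exists z (g : hom y z) (h : hom z (shift x)), dist f g h /\ T z.

Lemma iso_cone_in (x y : K) (f : hom x y) : is_iso f -> cone_in f.
Proof.
move=> fi; have [[o o0] _] := tri_additive K.
have [T0 _ _ _] := T_thick.
exists o, 0, 0; split; last exact: T0.
apply: (dist_iso (a := idm x) (b := f) (c := idm o) _ _ _ _ _ _ (dist_id x o0));
  rewrite ?comp0m ?compm0 ?compm1 //; exact: idm_iso.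
Qed.

(** The octahedral axiom places the cone of the composite in a triangle between the two given
    cones. *)
Lemma comp_cone_in (x y z : K) (g : hom y z) (f : hom x y) :
  cone_in g -> cone_in f -> cone_in (g ∘ f).
Proof.
move=> [x' [g1 [g2 [dg Tx']]]] [z' [f1 [f2 [df Tz']]]].
have [y' [h1 [h2 dh]]] := dist_cone (g ∘ f).
have [u [v [d _ _ _ _]]] := dist_oct df dg dh.
by exists y', h1, h2; split=> //; apply: thick_dist2 d Tz' Tx'.
Qed.

(** The triangle on a zero morphism splits: its cone is the sum of [y] and the suspension of [x], so
    [y] is a summand of an object of [T]. *)
Lemma cone_in0 (x y : K) : cone_in (0 : hom x y) -> T y.
Proof.
move=> [z [g [h [d Tz]]]].
have [r rg] : exists r, r ∘ g = idm y by apply: dist_lift d _; rewrite compm0.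
have /dist_rot d' := d; have hg := dist_comp0 d'.
(* In the rotated triangle the map after [h] is the suspension of 0 up to sign, and every [k] with
   [k ∘ h = 0] factors through it. *)
have h_epi t (k : hom _ t) : k ∘ h = 0 -> k = 0.
  have /dist_rot d'' := d'; move=> /(dist_lift d'') [l <-].
  by rewrite (fmap0 _ _ (@shift_additive K)) oppr0 compm0.
have [s sh] : exists s, s ∘ h = idm z - g ∘ r.
  apply: dist_lift d' _.
  by rewrite compDl compNm comp1m -compA rg compm1 subrr.
have [_ _ _ Tsum] := T_thick.
have [] // := Tsum _ _ _ g s r h.
split=> //.
- apply/eqP; rewrite -subr_eq0; apply/eqP/h_epi.
  by rewrite compDl compNm comp1m -compA sh compDr compmN compm1 compA hg
             comp0m subr0 subrr.
- apply: h_epi.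
  by rewrite -compA sh compDr compmN compm1 compA rg comp1m subrr.
- by rewrite sh addrC subrK.
Qed.

End Thick.

Lemma thick_preimage (C D : monTriCat) (F : functor C D) (T : set D) :
  exact_functor F -> thick T -> thick (F @^-1` T)%classic.
Proof.
move=> [Fadd [th [th_iso _ th_dist]]] Tth.
have [T0 Tshift Ttri Tsum] := Tth.
split=> /=.
- move=> z z0; apply: T0; apply: is_zero_id.
  by rewrite -fmap1 ((z0 z).1 (idm z)) fmap0.
- move=> x; apply: (iff_trans (Tshift _)); apply: iff_sym.
  exact: (thick_iso Tth (th_iso x)).
- by move=> x y z f g h /th_dist; apply: Ttri.
- move=> x y s i1 i2 p1 p2 [h1 h2 h3 h4 h5].
  apply: (Tsum _ _ _ (fmap F i1) (fmap F i2) (fmap F p1) (fmap F p2)).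
  by split; rewrite -!fmapM ?h1 ?h2 ?h3 ?h4 ?fmap1 ?fmap0 // -Fadd h5 fmap1.
Qed.

Lemma cone_in_fmap (C D : monTriCat) (F : functor C D) (S : set C) (T : set D)
    (x y : C) (f : hom x y) :
  exact_functor F -> (forall z, S z -> T (F z)) ->
  cone_in S f -> cone_in T (fmap F f).
Proof.
move=> [_ [th [_ _ th_dist]]] ST [z [g [h [/th_dist d Sz]]]].
by exists (F z), (fmap F g), (th x ∘ fmap F h); split=> //; apply: ST.
Qed.

(** * Tensoring in one variable, tensor powers and duals *)

Section Tensor.
Variable K : monTriCat.

Lemma tensmDl (x x' y y' : K) (f f' : hom x x') (g : hom y y') :
  (f + f') ⊗₁ g = f ⊗₁ g + f' ⊗₁ g.
Proof. by have [tDl _ _ _] := mt_exact K; apply: tDl. Qed.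

Lemma tensmDr (x x' y y' : K) (f : hom x x') (g g' : hom y y') :
  f ⊗₁ (g + g') = f ⊗₁ g + f ⊗₁ g'.
Proof. by have [_ tDr _ _] := mt_exact K; apply: tDr. Qed.

Lemma tens0m (x x' y y' : K) (g : hom y y') : (0 : hom x x') ⊗₁ g = 0.
Proof. by apply: (addrI (0 ⊗₁ g)); rewrite -tensmDl !addr0. Qed.

Lemma tensm0 (x x' y y' : K) (f : hom x x') : f ⊗₁ (0 : hom y y') = 0.
Proof. by apply: (addrI (f ⊗₁ 0)); rewrite -tensmDr !addr0. Qed.

Lemma tensmEl (x x' y y' : K) (f : hom x x') (g : hom y y') :
  f ⊗₁ g = (f ⊗₁ idm y') ∘ (idm x ⊗₁ g).
Proof. by rewrite -tensmM compm1 comp1m. Qed.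

Lemma tensmEr (x x' y y' : K) (f : hom x x') (g : hom y y') :
  f ⊗₁ g = (idm x' ⊗₁ g) ∘ (f ⊗₁ idm y).
Proof. by rewrite -tensmM compm1 comp1m. Qed.

Lemma tens_idm_comp (x y y' y'' : K) (g : hom y' y'') (f : hom y y') :
  idm x ⊗₁ (g ∘ f) = (idm x ⊗₁ g) ∘ (idm x ⊗₁ f).
Proof. by rewrite -tensmM comp1m. Qed.

Lemma tens_comp_idm (x x' x'' y : K) (g : hom x' x'') (f : hom x x') :
  (g ∘ f) ⊗₁ idm y = (g ⊗₁ idm y) ∘ (f ⊗₁ idm y).
Proof. by rewrite -tensmM comp1m. Qed.

Lemma tensm_iso (x x' y y' : K) (f : hom x x') (g : hom y y') :
  is_iso f -> is_iso g -> is_iso (f ⊗₁ g).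
Proof.
move=> [f' [fK Kf]] [g' [gK Kg]]; exists (f' ⊗₁ g').
by split; rewrite -tensmM ?fK ?gK ?Kf ?Kg tensm1.
Qed.

Lemma assoc_iso (x y z : K) : is_iso (α x y z).
Proof. by exists (αV x y z); apply: assocK. Qed.

Lemma lunit_iso (x : K) : is_iso (λ x).
Proof. by exists (λV x); apply: lunitK. Qed.

Definition tensl (w : K) : functor K K :=
  @Functor K K (fun x => w ⊗ x) (fun x y f => idm w ⊗₁ f)
    (fun x => tensm1 _ w x) (fun x y z g f => tens_idm_comp w g f).

Definition tensr (w : K) : functor K K :=
  @Functor K K (fun x => x ⊗ w) (fun x y f => f ⊗₁ idm w)
    (fun x => tensm1 _ x w) (fun x y z g f => tens_comp_idm w g f).

Lemma tensl_exact (w : K) : exact_functor (tensl w).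
Proof.
have [_ _ _ [th [thi thn thd]]] := mt_exact K.
split=> [x y f g|]; first exact: tensmDr.
exists (th w).
by split=> [x|x y f|x y z f g h]; [exact: thi|exact: thn|exact: thd].
Qed.

Lemma tensr_exact (w : K) : exact_functor (tensr w).
Proof.
have [_ _ [th [thi thn thd]] _] := mt_exact K.
split=> [x y f g|]; first exact: tensmDl.
exists (fun x => th x w).
by split=> [x|x y f|x y z f g h]; [exact: thi|exact: thn|exact: thd].
Qed.

Lemma cone_in_tens (T : set K) (x x' y y' : K) (f : hom x x')
    (g : hom y y') :
  thick_ideal T -> cone_in T f -> cone_in T g -> cone_in T (f ⊗₁ g).
Proof.
move=> [Tth TR TL] fT gT; rewrite tensmEl; apply: comp_cone_in => //.
- by apply: cone_in_fmap (tensr_exact y') _ fT => z; apply: TR.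
- by apply: cone_in_fmap (tensl_exact x) _ gT => z; apply: TL.
Qed.

Lemma cone_in_tpowm (T : set K) (x y : K) (f : hom x y) (n : nat) :
  thick_ideal T -> cone_in T f -> cone_in T (tpowm f n).
Proof.
move=> Tid fT; elim: n => [|[|n] IHn] //=; last exact: cone_in_tens.
by have [Tth _ _] := Tid; apply: iso_cone_in => //; apply: idm_iso.
Qed.

Lemma completely_prime_unit (P : set K) :
  completely_prime P -> ~ P (unit_obj K).
Proof.
move=> [[Pth PR _] Pproper _] P1; apply: Pproper; apply/seteqP; split=> // y _.
by apply/(thick_iso Pth (lunit_iso y)); apply: PR.
Qed.

Lemma completely_prime_tpow (P : set K) (x : K) (n : nat) :
  completely_prime P -> P (tpow x n) -> P x.
Proof.
move=> Pcp; elim: n => [|[|n] IHn] //=; first by move/completely_prime_unit.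
by have [_ _ Pprime] := Pcp; move=> /Pprime [].
Qed.

(** By the zigzag identity [λ x] factors through [coev ⊗₁ idm x], which kills [xi ⊗₁ idm x]. *)
Lemma fiber_coev_tens0 (x d w : K) (ev : hom (d ⊗ x) (unit_obj K))
    (coev : hom (unit_obj K) (x ⊗ d)) (xi : hom w (unit_obj K)) :
  is_left_dual ev coev -> coev ∘ xi = 0 -> xi ⊗₁ idm x = 0.
Proof.
move=> [zigzag _] xi0; apply: (iso_comp_eq0 (lunit_iso x)).
have <- : ρ x ∘ (idm x ⊗₁ ev) ∘ α x d x ∘ (coev ⊗₁ idm x) = λ x.
  have [lVK lKV] := lunitK (mt_monoidal K) x.
  by rewrite -[LHS]compm1 -lVK compA zigzag comp1m.
by rewrite -compA -tens_comp_idm xi0 tens0m compm0.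
Qed.

End Tensor.

(** * Objects annihilated by tensoring with a fixed morphism *)

Section Killed.
Variable L : monTriCat.

Section OneMorphism.
Variables (a b : L) (u : hom a b).

(** The suspension isomorphism identifies [u ⊗₁ idm (shift d)] with the suspension of [u ⊗₁ idm d],
    and the shift is faithful. *)
Lemma tens_shift_eq0 (d : L) :
  u ⊗₁ idm d = 0 <-> u ⊗₁ idm (shift d) = 0.
Proof.
have [_ _ _ [th [thi thn _]]] := mt_exact L.
have e : th b d ∘ (u ⊗₁ idm (shift d)) = fmap shift (u ⊗₁ idm d) ∘ th a d.
  by rewrite -thn fmap1.
have S0 := fmap0 _ _ (@shift_additive L).
split=> u0; first by apply: (iso_comp_eq0 (thi b d)); rewrite e u0 S0 comp0m.
apply: (equivalence_faithful (shift_equivalence L)); rewrite S0.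
by apply: (comp_iso_eq0 (thi a d)); rewrite -e u0 compm0.
Qed.

Lemma tens_retract_eq0 (x s : L) (i : hom x s) (p : hom s x) :
  p ∘ i = idm x -> u ⊗₁ idm s = 0 -> u ⊗₁ idm x = 0.
Proof.
move=> pi us; rewrite -pi tensmEl tens_idm_comp compA -tensmEl tensmEr us.
by rewrite compm0 comp0m.
Qed.

Lemma tens_right_eq0 (d y : L) : u ⊗₁ idm d = 0 -> u ⊗₁ idm (d ⊗ y) = 0.
Proof.
move=> ud; apply: (comp_iso_eq0 (assoc_iso _ d y)).
by rewrite -tensm1 -assoc_nat ud tens0m compm0.
Qed.

(** Restricted along [idm a ⊗₁ g], the morphism [u ⊗₁ idm z] passes through [u ⊗₁ idm y = 0]; hence
    it factors through the next map of the triangle tensored with [a]. *)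
Lemma tens_dist_factor (x y z : L) (f : hom x y) (g : hom y z)
    (h : hom z (shift x)) :
  dist f g h -> u ⊗₁ idm y = 0 ->
  exists l : hom (a ⊗ shift x) (b ⊗ z), u ⊗₁ idm z = l ∘ (idm a ⊗₁ h).
Proof.
have [_ _ _ [th [_ _ thd]]] := mt_exact L.
move=> /(thd _ _ _ a) /dist_rot d uy.
have [|l <-] := dist_lift (k := u ⊗₁ idm z) d.
  by rewrite -tensmEl tensmEr uy compm0.
by exists (l ∘ th a x); rewrite compA.
Qed.

End OneMorphism.

(* The triangle makes [u ⊗ z] factor through [a ⊗ h], and [h] is natural with
   respect to the morphism [u'] that kills [shift x]. *)
Lemma tens_dist_eq0 (a a' b b' : L) (u : hom a b) (u' : hom a' b')
    (n : forall d : L, hom (b' ⊗ d) d) (x y z : L) (f : hom x y) (g : hom y z)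
    (h : hom z (shift x)) :
  (forall d, is_iso (n d)) ->
  (forall d d' (k : hom d d'), n d' ∘ (idm b' ⊗₁ k) = k ∘ n d) ->
  dist f g h -> u' ⊗₁ idm x = 0 -> u ⊗₁ idm y = 0 ->
  u ⊗₁ (u' ⊗₁ idm z) = 0.
Proof.
move=> n_iso n_nat d /tens_shift_eq0 u'x uy.
have [l uz] := tens_dist_factor d uy.
apply: (iso_comp_eq0 (tensm_iso (idm_iso b) (n_iso z))).
rewrite -tensmM comp1m tensmEl uz -compA -tens_idm_comp compA -n_nat -compA.
by rewrite -tensmEr (tensmEl u') u'x comp0m compm0 tensm0 compm0.
Qed.

End Killed.

(** * The ideal of [L] killed by images of P-morphisms *)

Section Lift.
Variables (K L : monTriCat) (F : exactTensorFunctor K L).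

Lemma etf_tens_eq0 (x x' y y' : K) (f : hom x x') (g : hom y y') :
  fmap F f ⊗₁ fmap F g = 0 <-> fmap F (f ⊗₁ g) = 0.
Proof.
split=> fg0.
- by apply: (comp_iso_eq0 (etf_mu_iso F x y)); rewrite -etf_mu_nat fg0 compm0.
- by apply: (iso_comp_eq0 (etf_mu_iso F x' y')); rewrite etf_mu_nat fg0 comp0m.
Qed.

(** [F] preserves the unit only up to isomorphism; this supplies the natural family [n] required by
    [tens_dist_eq0]. *)
Lemma etf_unit_tens : exists n : forall d : L, hom (F (unit_obj K) ⊗ d) d,
  (forall d, is_iso (n d)) /\
  forall d d' (k : hom d d'), n d' ∘ (idm _ ⊗₁ k) = k ∘ n d.
Proof.
have [e [epsK Keps]] := etf_eps_iso F.
exists (fun d => λ d ∘ (e ⊗₁ idm d)); split=> [d|d d' k].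
  have [l [lK Kl]] := lunit_iso d.
  exists ((etf_eps F ⊗₁ idm d) ∘ l).
  split.
    by rewrite -compA (compA l) lK comp1m -tens_comp_idm Keps tensm1.
  by rewrite -compA (compA (e ⊗₁ _)) -tens_comp_idm epsK tensm1 comp1m.
by rewrite -compA -tensmEl tensmEr compA lunit_nat compA.
Qed.

(** This is the ideal J. Morphisms into the unit are used because [xi ⊗₁ xi'] followed by [λ] is
    again one. *)
Definition killed (P : set K) : set L :=
  [set d | exists w (xi : hom w (unit_obj K)),
             cone_in P xi /\ fmap F xi ⊗₁ idm d = 0].

(** Since [fmap F xi] stands to the left of [d], closure under tensoring on the right is immediate
    from associativity. *)
Lemma killed_right_ideal (P : set K) :
  thick_ideal P -> thick_right_ideal (killed P).
Proof.
move=> Pid; have [Pth _ _] := Pid; split; last first.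
  move=> x y [w [xi [Pxi xi0]]]; exists w, xi; split=> //.
  exact: tens_right_eq0.
split.
- move=> z z0; exists _, (idm _); split; first exact/iso_cone_in/idm_iso.
  by rewrite ((z0 z).1 (idm z)) tensm0.
- by move=> x; split=> -[w [xi [Pxi xi0]]]; exists w, xi; split=> //;
    [apply: (tens_shift_eq0 _ x).1 | apply: (tens_shift_eq0 _ x).2].
- move=> x y z f g h d [w' [xi' [Pxi' xi'x]]] [w [xi [Pxi xiy]]].
  (* The cone is killed by the product of the two witnesses, with the one for [y] on the left, as in
     [tens_dist_eq0]. *)
  exists (w ⊗ w'), (λ _ ∘ (xi ⊗₁ xi')); split.
    apply: comp_cone_in => //; last exact: cone_in_tens.
    exact/iso_cone_in/lunit_iso.
  have [n [n_iso n_nat]] := etf_unit_tens.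
  have e0 := tens_dist_eq0 n_iso n_nat d xi'x xiy.
  apply: (comp_iso_eq0 (tensm_iso (etf_mu_iso F w w') (idm_iso z))).
  rewrite -tens_comp_idm fmapM -compA -etf_mu_nat compA tens_comp_idm.
  rewrite [X in _ ∘ X](_ : _ = 0) ?compm0 //.
  by apply: (iso_comp_eq0 (assoc_iso _ _ _)); rewrite assoc_nat e0 comp0m.
- move=> x y s i1 i2 p1 p2 [h1 h2 _ _ _] [w [xi [Pxi xi0]]].
  by split; exists w, xi; split=> //; [apply: tens_retract_eq0 h1 _
                                     |apply: tens_retract_eq0 h2 _].
Qed.

Lemma image_killed (P : set K) (x : K) :
  rigid K -> thick_ideal P -> P x -> killed P (F x).
Proof.
move=> [[D [ev [coev [dual _]]]] _] [_ PR _] Px.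
have [w [xi [h d]]] := dist_fiber (coev x).
exists w, xi; split.
  by exists (x ⊗ D x), (coev x), h; split=> //; apply: PR.
rewrite -fmap1; apply/etf_tens_eq0.
rewrite (fiber_coev_tens0 (dual x) (dist_comp0 d)).
by rewrite fmap0 //; case: (etf_exact F).
Qed.

Lemma killed_image (P : set K) (s : K) :
  detects_tensor_nilpotents F -> completely_prime P -> killed P (F s) -> P s.
Proof.
move=> F_nil Pcp [w [xi [Pxi]]].
have [Pid _ _] := Pcp; have [Pth _ _] := Pid.
rewrite -fmap1 => /etf_tens_eq0 /F_nil [n _ n0].
(* The nilpotent morphism [xi ⊗₁ idm s] has target [unit_obj K ⊗ s], so membership is tested
   there. *)
apply/(thick_iso Pth (lunit_iso s)).
apply: (completely_prime_tpow (n := n) Pcp).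
have : cone_in P (tpowm (xi ⊗₁ idm s) n); last by rewrite n0 => /(cone_in0 Pth).
apply: cone_in_tpowm => //; apply: cone_in_tens => //.
exact/iso_cone_in/idm_iso.
Qed.

End Lift.

(** * Maximal thick ideals avoiding a set of objects *)

Section Maximal.
Variables (L : monTriCat) (S : set L).

(** Totality is used for triangles: two of the objects lie in a common member of the chain. *)
Lemma thick_ideal_bigcup (G : set (set L)) :
  G !=set0 -> total_on G subset -> (forall T, G T -> thick_ideal T) ->
  thick_ideal (\bigcup_(T in G) T).
Proof.
move=> [T0 GT0] Gtot Gid; split; [split|..].
- move=> z z0; exists T0 => //.
  by have [[T00 _ _ _] _ _] := Gid _ GT0; apply: T00.
- move=> x; split=> -[T GT Tx]; exists T => //;
    have [[_ Tshift _ _] _ _] := Gid _ GT;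
    [exact: (Tshift x).1 | exact: (Tshift x).2].
- move=> x y z f g h d [T GT Tx] [U GU Uy].
  have [TU|UT] := Gtot _ _ GT GU.
    exists U => //; have [[_ _ Utri _] _ _] := Gid _ GU.
    by apply: Utri d _ Uy; apply: TU.
  exists T => //; have [[_ _ Ttri _] _ _] := Gid _ GT.
  by apply: Ttri d Tx _; apply: UT.
- move=> x y s i1 i2 p1 p2 b [T GT Ts].
  have [[_ _ _ Tsum] _ _] := Gid _ GT.
  by have [Tx Ty] := Tsum _ _ _ _ _ _ _ b Ts; split; exists T.
- by move=> x y [T GT Tx]; exists T => //; have [_ TR _] := Gid _ GT; apply: TR.
- by move=> x y [T GT Tx]; exists T => //; have [_ _ TL] := Gid _ GT; apply: TL.
Qed.

Lemma maximal_avoiding_ideal (J : set L) :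
  thick_ideal J -> J `<=` ~` S ->
  exists Q, [/\ thick_ideal Q, J `<=` Q, Q `<=` ~` S &
    forall T, thick_ideal T -> Q `<=` T -> T `<=` ~` S -> T `<=` Q].
Proof.
move=> Jid JS.
(* Zorn_bigcup also takes the union of the empty chain, hence [J `|` X]. *)
pose good X := thick_ideal (J `|` X) /\ J `|` X `<=` ~` S.
have [G Ggood Gtot|A [[Aid AS] Amax]] := @Zorn_bigcup L good.
  have [->|G0] := eqVneq G set0; first by rewrite /good bigcup_set0 setU0.
  have /set0P [X0 GX0] := G0.
  (* For a nonempty chain, [J] can be joined to each member, which gives a chain of thick ideals. *)
  rewrite /good (_ : J `|` _ = \bigcup_(T in setU J @` G) T).
    split; last by move=> x [_ [X GX <-]]; apply: (Ggood X GX).2.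
    apply: thick_ideal_bigcup; first by exists (J `|` X0); exists X0.
      move=> _ _ [X GX <-] [Y GY <-].
      by have [XY|YX] := Gtot _ _ GX GY; [left|right]; apply: setUS.
    by move=> _ [X GX <-]; apply: (Ggood X GX).1.
  rewrite bigcup_image; apply/seteqP; split=> x.
    by move=> [Jx|[X GX Xx]]; [exists X0 => //; left|exists X => //; right].
  by move=> [X GX [Jx|Xx]]; [left|right; exists X].
exists (J `|` A); split=> // T Tid QT TS; apply: contrapT => TQ.
have JT : J `|` T = T by apply: setUidr => x Jx; apply: QT; left.
apply: (Amax T); last by rewrite /good JT.
by split=> [x Ax|TA]; [apply: QT; right|apply: TQ => x Tx; right; apply: TA].
Qed.

(** Krull's argument with conductors: if [a] and [b] are outside [Q] but their product is in [Q],
    each factor is replaced in turn by an element of [S]. The element [z] allows [S] to be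
    multiplicative only up to isomorphism. *)
Lemma maximal_avoiding_prime (Q : set L) :
  duo L -> thick_ideal Q -> S !=set0 -> Q `<=` ~` S ->
  (forall x y, S x -> S y -> exists2 z, S z & Q (x ⊗ y) -> Q z) ->
  (forall T, thick_ideal T -> Q `<=` T -> T `<=` ~` S -> T `<=` Q) ->
  completely_prime Q.
Proof.
move=> [duoR duoL] Qid [s0 Ss0] QS Smul Qmax.
have [Qth QR QL] := Qid.
split=> // [QT|a b Qab]; first by apply: QS Ss0; rewrite QT.
(* By maximality, a thick ideal strictly larger than [Q] meets [S]. *)
have meet T c : thick_ideal T -> Q `<=` T -> T c -> ~ Q c ->
    exists2 s, T s & S s.
  move=> Tid QT Tc Qc; apply: contrapT => TS; apply: Qc; apply: Qmax Tc => //.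
  by move=> s Ts Ss; apply: TS; exists s.
apply: contrapT => /not_orP [Qa Qb].
(* This conductor is a left ideal and the later [B] a right one; duo makes both two-sided. *)
pose A := [set c | Q (c ⊗ b)].
have Aid : thick_ideal A.
  apply: duoL; split; first exact: thick_preimage (tensr_exact b) Qth.
  move=> x y Ax; apply/(thick_iso Qth (assoc_iso y x b)); exact: QL.
have [s As Ss] := meet A a Aid (fun c => QR c b) Qab Qa.
pose B := [set d | Q (s ⊗ d)].
have Bid : thick_ideal B.
  apply: duoR; split; first exact: thick_preimage (tensl_exact s) Qth.
  move=> x y Bx; apply/(thick_iso Qth (assoc_iso s x y)); exact: QR.
have [t Bt St] := meet B b Bid (fun d => QL d s) As Qb.
by have [z Sz Qz] := Smul s t Ss St; apply: (QS z) => //; apply: Qz.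
Qed.

End Maximal.

(** * Construction of a completely prime ideal above a given one *)

Theorem theoremF (K L : monTriCat) (K_rigid : rigid K) (L_duo : duo L)
    (F : exactTensorFunctor K L) (F_nil : detects_tensor_nilpotents F) :
  forall P : Spc_cp K, exists Q : Spc_cp L, Spc_cp_map F Q = P.
Proof.
move=> [P Pcp].
have [Pid _ Pprime] := Pcp.
have Jid := L_duo.1 _ (killed_right_ideal F Pid).
pose S := F @` (~` P).
have JS : killed F P `<=` ~` S.
  move=> d Js [s Ps eFs]; apply: Ps.
  by apply: killed_image F_nil Pcp _; rewrite eFs.
have [Q [Qid JQ QS Qmax]] := maximal_avoiding_ideal Jid JS.
have [Qth _ _] := Qid.
have Qcp : completely_prime Q.
  apply: (maximal_avoiding_prime L_duo Qid _ QS _ Qmax).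
    exists (F (unit_obj K)); exists (unit_obj K) => //.
    exact: completely_prime_unit.
  move=> _ _ [s Ps <-] [t Pt <-]; exists (F (s ⊗ t)).
    by exists (s ⊗ t) => // /Pprime [].
  by move/(thick_iso Qth (etf_mu_iso F s t)).
exists (SpcCp Qcp).
(* One inclusion holds because [Q] avoids the image of the complement of [P], the other because [Q]
   contains J and hence the image of [P]. *)
have e : F @^-1` Q = P.
  apply/seteqP; split=> x /= Qx.
    by apply: contrapT => Px; apply: QS Qx _; exists x.
  by apply: JQ; apply: image_killed.
rewrite /Spc_cp_map /=; move: (completely_prime_preimage _ _).
rewrite /= e => Pcp'.
by congr SpcCp; apply: Prop_irrelevance.
Qed.
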